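(* Let $\mathbb{D}=\{z\in\mathbb{C}:|z|<1\}$ and let $f:\mathbb{D}\to\mathbb{C}$ be Morera-holomorphic. Then there is a sequence $\{a_n\}_{n=0}^\infty$ of complex numbers such that $$f=\sum_{n=0}^\infty a_ne_n,\qquad e_n(z)=z^n,$$ where the series on the right converges absolutely in $\mathcal{C}(\mathbb{D})$ to the function $f$.
   Context: For an open set $\Omega\subset\mathbb{C}$, a continuous function $f:\Omega\to\mathbb{C}$ is Morera-holomorphic if $\int_{\partial T}f(z)\,dz=0$ for each triangle $T$ contained (with its interior) in $\Omega$, where $\partial T$ is oriented counterclockwise. $\mathcal{C}(\mathbb{D})$ is the Fréchet space of continuous complex-valued functions on $\mathbb{D}$, with topology generated by the seminorms $p_r(g)=\sup_{|z|\le r}|g(z)|$, $0<r<1$. Absolute convergence of $\sum_n g_n$ in $\mathcal{C}(\mathbb{D})$ means $\sum_n p(g_n)<\infty$ for every continuous seminorm $p$ on $\mathcal{C}(\mathbb{D})$ (equivalently, for each $p_r$, $0<r<1$). *)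

(* Defs.v *)
From Stdlib Require Import Reals List.
From Coquelicot Require Import Coquelicot.

Open Scope R_scope.

(** Functions on a subset of [C] are represented by total functions [C -> C];
    every notion below depends only on their values on that subset. *)

(** ** Morera-holomorphic functions *)

(** The integral of [f(z) dz] along the oriented segment from [a] to [b]. *)
Definition segment_integral (f : C -> C) (a b : C) : C :=
  RInt (V := C_R_CompleteNormedModule)
    (fun t : R => (f (a + t * (b - a)) * (b - a))%C) 0 1.

Definition closed_triangle (a b c : C) (z : C) : Prop :=
  exists s t u : R,
    0 <= s /\ 0 <= t /\ 0 <= u /\ s + t + u = 1 /\
    z = (s * a + t * b + u * c)%C.

(** [Im (conj (b - a) * (c - a))] is twice the signed area of the triangle:
    it is positive iff the triangle is nondegenerate and [a], [b], [c] are its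
    vertices in counterclockwise order. *)
Definition counterclockwise (a b c : C) : Prop :=
  0 < Im (Cconj (b - a) * (c - a))%C.

Definition triangle_integral (f : C -> C) (a b c : C) : C :=
  (segment_integral f a b + segment_integral f b c + segment_integral f c a)%C.

(** To be used for an open set [Omega]. *)
Definition morera_holomorphic (Omega : C -> Prop) (f : C -> C) : Prop :=
  continuous_on Omega f /\
  forall a b c : C,
    counterclockwise a b c ->
    (forall z : C, closed_triangle a b c z -> Omega z) ->
    triangle_integral f a b c = RtoC 0.

(** ** The Frechet space of continuous functions on the unit disc *)

Definition unit_disc (z : C) : Prop := Cmod z < 1.

Definition C_disc (g : C -> C) : Prop := continuous_on unit_disc g.

(** The supremum of [|g|] over [|z| <= r]. It is finite when [g] is in [C_disc]
    and [0 < r < 1], the only case in which it is used. *)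
Definition sup_seminorm (r : R) (g : C -> C) : R :=
  real (Lub_Rbar (fun y : R => exists z : C, Cmod z <= r /\ y = Cmod (g z))).

(** The neighbourhoods of [g] in the topology of [C_disc] generated by the
    seminorms [sup_seminorm r], [0 < r < 1]: a basic neighbourhood is given by
    finitely many radii and a tolerance. *)
Definition nbhs_C_disc (g : C -> C) (V : (C -> C) -> Prop) : Prop :=
  exists (radii : list R) (eps : posreal),
    (forall r : R, In r radii -> 0 < r < 1) /\
    forall h : C -> C, C_disc h ->
      (forall r : R, In r radii ->
         sup_seminorm r (fun z => (h z - g z)%C) < eps) ->
      V h.

(** [seminorm_ext] makes [p] a function on [C_disc] proper, where functions
    that agree on the disc are equal. *)
Record seminorm_C_disc (p : (C -> C) -> R) : Prop := {
  seminorm_ext : forall g h : C -> C, C_disc g -> C_disc h ->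
    (forall z : C, unit_disc z -> g z = h z) -> p g = p h;
  seminorm_ge_0 : forall g : C -> C, C_disc g -> 0 <= p g;
  seminorm_add : forall g h : C -> C, C_disc g -> C_disc h ->
    p (fun z => (g z + h z)%C) <= p g + p h;
  seminorm_scal : forall (c : C) (g : C -> C), C_disc g ->
    p (fun z => (c * g z)%C) = Cmod c * p g
}.

Definition continuous_seminorm_C_disc (p : (C -> C) -> R) : Prop :=
  seminorm_C_disc p /\
  forall g : C -> C, C_disc g -> filterlim p (nbhs_C_disc g) (locally (p g)).

Definition absolutely_convergent_C_disc (g : nat -> C -> C) : Prop :=
  forall p : (C -> C) -> R, continuous_seminorm_C_disc p ->
    ex_series (fun n : nat => p (g n)).

Definition series_converges_C_disc (g : nat -> C -> C) (f : C -> C) : Prop :=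
  C_disc f /\ (forall n : nat, C_disc (g n)) /\
  filterlim (fun (N : nat) (z : C) => sum_n (fun n => g n z) N)
    eventually (nbhs_C_disc f).

Definition monomial (n : nat) (z : C) : C := (z ^ n)%C.

(* Main.v *)
Require Import Defs.
From Stdlib Require Import Reals.
From Coquelicot Require Import Coquelicot.
From Stdlib Require Import Lra Lia List.

(** Integrating [f] along radii gives a primitive [F] of [f]: the vanishing of
    the triangle integrals says that [F b - F a] is the integral of [f] over the
    segment from [a] to [b] ([primitive_minus]), and continuity of [f] then gives
    [F' = f].  So [F] is holomorphic with a continuous derivative, which is what
    the elementary proof of Cauchy's formula needs.

    Fix [|z| < r < 1], let [w] run over the circle of radius [r], and contract the
    circle to [z]: with all integrals taken over [0 <= t <= 2 * PI], put
<<
      G(s) = int F(z + s(w - z)) w / (w - z)^2 dt,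
      K(s) = int f(z + s(w - z)) w / (w - z) dt.
>>
    Differentiation under the integral sign gives [G' = K]; integrating the
    derivative in [t] of the periodic function [F(z + s(w - z)) / (w - z)] gives
    [s K(s) = G(s)].  Hence [G(s) / s] is constant on (0, 1] and equal to
    [G'(0) = K(0) = 2 PI f(z)].  At [s = 1] this is the formula
    ([cauchy_formula])
<<
      2 PI f(z) = int F(w) w / (w - z)^2 dt,
>>
    which expresses the values of [f], and not only those of [F], by integrals
    whose dependence on [z] is explicit.

    The finite expansion of [w / (w - z)^2] in powers of [z / w] gives partial sums
    of a power series in [z], with an explicit remainder that is at most a constant
    times [n (s / r)^n] for [|z| <= s < r] ([cauchy_series_remainder_bound]).  The
    coefficients depend on [r] a priori, but the uniqueness of power series
    identifies them for all [r < 1] ([cauchy_coef_radius]), so that one series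
    converges to [f] uniformly on every smaller disc.

    Finally, a continuous seminorm is bounded by a multiple of the supremum over one
    disc of radius [s < 1] ([continuous_seminorm_bound]), so that absolute convergence
    reduces to the convergence of [sum |a_n| s^n]. *)

Notation is_derive_C := (is_derive (V := C_R_NormedModule)).

(** * Continuity, derivatives and integrals of complex-valued functions *)

Lemma norm_C_R (z : C) : norm (V := C_R_NormedModule) z = Cmod z.
Proof.
  unfold norm, Cmod; simpl; unfold prod_norm, norm; simpl; unfold abs; simpl.
  f_equal. now rewrite !Rmult_1_r, <- !Rsqr_def, <- !Rsqr_abs.
Qed.

Lemma Cmod_minus_sym (x y : C) : Cmod (x - y) = Cmod (y - x).
Proof. rewrite <- Cmod_opp. f_equal. ring. Qed.

(** The uniform structure of [C] is that of the product [R * R], whose balls are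
    squares; this passes to round discs. *)
Lemma locally_Cmod (z : C) (P : C -> Prop) :
  locally z P <->
  exists d : posreal, forall y : C, Cmod (y - z) < d -> P y.
Proof.
  rewrite locally_C. split.
  - intros [d Hd]. exists d. intros y Hy. apply Hd. exact Hy.
  - intros [d Hd]. exists d. intros y Hy. apply Hd. exact Hy.
Qed.

Section Continuity.
Context {U : UniformSpace}.

Lemma continuous_Rplus (f g : U -> R) (x : U) :
  continuous f x -> continuous g x -> continuous (fun t => f t + g t) x.
Proof. apply (continuous_plus (V := R_NormedModule)). Qed.

Lemma continuous_Rminus (f g : U -> R) (x : U) :
  continuous f x -> continuous g x -> continuous (fun t => f t - g t) x.
Proof. apply (continuous_minus (V := R_NormedModule)). Qed.

Lemma continuous_Rmult (f g : U -> R) (x : U) :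
  continuous f x -> continuous g x -> continuous (fun t => f t * g t) x.
Proof. apply (continuous_mult (K := R_AbsRing)). Qed.

(** Products, inverses, derivatives and integrals of complex-valued functions are
    handled through their real and imaginary parts; this lemma and its analogues
    [is_derive_C_pair] and [is_CInt_pair] reassemble the parts. *)
Lemma continuous_C_pair (f : U -> C) (x : U) :
  continuous (fun t => fst (f t)) x -> continuous (fun t => snd (f t)) x ->
  continuous f x.
Proof.
  intros H1 H2.
  apply continuous_ext with (fun t => (fst (f t), snd (f t))).
  { intros t; now destruct (f t). }
  apply (continuous_comp_2 (fun t => fst (f t)) (fun t => snd (f t))
           (fun a b : R => (a, b)) x H1 H2).
  apply continuous_ext with (fun p : R * R => p); [now intros [] | apply continuous_id].
Qed.

Lemma continuous_C_fst (f : U -> C) (x : U) :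
  continuous f x -> continuous (fun t => fst (f t)) x.
Proof.
  intros H. apply (continuous_comp f fst x H).
  destruct (f x) as [a b]. apply continuous_fst.
Qed.

Lemma continuous_C_snd (f : U -> C) (x : U) :
  continuous f x -> continuous (fun t => snd (f t)) x.
Proof.
  intros H. apply (continuous_comp f snd x H).
  destruct (f x) as [a b]. apply continuous_snd.
Qed.

Lemma continuous_Cplus (f g : U -> C) (x : U) :
  continuous f x -> continuous g x -> continuous (fun t => (f t + g t)%C) x.
Proof.
  intros Hf Hg.
  apply continuous_C_pair; simpl; apply continuous_Rplus;
    auto using continuous_C_fst, continuous_C_snd.
Qed.

Lemma continuous_Cmult (f g : U -> C) (x : U) :
  continuous f x -> continuous g x -> continuous (fun t => (f t * g t)%C) x.
Proof.
  intros Hf Hg.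
  pose proof (continuous_C_fst _ _ Hf). pose proof (continuous_C_snd _ _ Hf).
  pose proof (continuous_C_fst _ _ Hg). pose proof (continuous_C_snd _ _ Hg).
  apply continuous_C_pair; simpl.
  - apply continuous_Rminus; now apply continuous_Rmult.
  - apply continuous_Rplus; now apply continuous_Rmult.
Qed.

Lemma continuous_Copp (f : U -> C) (x : U) :
  continuous f x -> continuous (fun t => (- f t)%C) x.
Proof.
  intros Hf. apply continuous_ext with (fun t => (RtoC (-1) * f t)%C).
  { intros t. apply injective_projections; simpl; ring. }
  apply continuous_Cmult; [apply continuous_const | exact Hf].
Qed.

Lemma continuous_Cminus (f g : U -> C) (x : U) :
  continuous f x -> continuous g x -> continuous (fun t => (f t - g t)%C) x.
Proof. intros Hf Hg. now apply continuous_Cplus, continuous_Copp. Qed.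

Lemma continuous_RtoC (f : U -> R) (x : U) :
  continuous f x -> continuous (fun t => RtoC (f t)) x.
Proof. intros Hf. apply continuous_C_pair; simpl; [exact Hf | apply continuous_const]. Qed.

Lemma continuous_Cinv (f : U -> C) (x : U) :
  continuous f x -> f x <> 0 -> continuous (fun t => (/ f t)%C) x.
Proof.
  intros Hf Hx.
  pose proof (continuous_C_fst _ _ Hf) as H1.
  pose proof (continuous_C_snd _ _ Hf) as H2.
  assert (Hn : fst (f x) ^ 2 + snd (f x) ^ 2 <> 0).
  { intros E. apply Hx, Cmod_eq_0. unfold Cmod. rewrite E. apply sqrt_0. }
  assert (Hd : continuous (fun t => / (fst (f t) ^ 2 + snd (f t) ^ 2)) x).
  { apply (continuous_comp (fun t => fst (f t) ^ 2 + snd (f t) ^ 2) Rinv).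
    - simpl. apply continuous_Rplus; (apply continuous_Rmult; [assumption |]);
        (apply continuous_Rmult; [assumption | apply continuous_const]).
    - now apply continuous_Rinv. }
  apply continuous_C_pair; simpl; unfold Rdiv;
    apply continuous_Rmult; try assumption.
  now apply (continuous_opp (V := R_NormedModule)).
Qed.

Lemma continuous_Cpow (f : U -> C) (n : nat) (x : U) :
  continuous f x -> continuous (fun t => (f t ^ n)%C) x.
Proof.
  intros Hf. induction n; simpl.
  - apply continuous_const.
  - now apply continuous_Cmult.
Qed.

End Continuity.

Lemma is_derive_C_pair (g : R -> C) (x : R) (l : C) :
  is_derive (fun t => fst (g t)) x (fst l) ->
  is_derive (fun t => snd (g t)) x (snd l) ->
  is_derive_C g x l.
Proof.
  intros H1 H2.
  apply is_derive_ext with (fun t => (fst (g t), snd (g t))).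
  { intros t; now destruct (g t). }
  unfold is_derive.
  eapply filterdiff_ext_lin.
  - apply (filterdiff_comp_2 (fun t => fst (g t)) (fun t => snd (g t))
      (fun a b : R => (a, b) : C_R_NormedModule) _ _
      (fun a b : R => (a, b) : C_R_NormedModule) H1 H2).
    apply (filterdiff_linear
      (U := prod_NormedModule R_AbsRing R_NormedModule R_NormedModule)
      (V := C_R_NormedModule)).
    split.
    + now intros [] [].
    + now intros k [].
    + exists 1. split; [lra|]. intros [a b]. simpl. rewrite Rmult_1_l. apply Rle_refl.
  - intros y. now destruct l.
Qed.

Lemma is_derive_C_fst (g : R -> C) (x : R) (l : C) :
  is_derive_C g x l ->
  is_derive (fun t => fst (g t)) x (fst l).
Proof.
  intros H. unfold is_derive in *.
  eapply filterdiff_ext_lin.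
  - apply (filterdiff_comp' (V := C_R_NormedModule) g
             (fst : C_R_NormedModule -> R_NormedModule) x _
             (fst : C_R_NormedModule -> R_NormedModule) H).
    apply filterdiff_linear, is_linear_fst.
  - now intros y.
Qed.

Lemma is_derive_C_snd (g : R -> C) (x : R) (l : C) :
  is_derive_C g x l ->
  is_derive (fun t => snd (g t)) x (snd l).
Proof.
  intros H. unfold is_derive in *.
  eapply filterdiff_ext_lin.
  - apply (filterdiff_comp' (V := C_R_NormedModule) g
             (snd : C_R_NormedModule -> R_NormedModule) x _
             (snd : C_R_NormedModule -> R_NormedModule) H).
    apply filterdiff_linear, is_linear_snd.
  - now intros y.
Qed.

Lemma is_derive_Cmult (g h : R -> C) (x : R) (dg dh : C) :
  is_derive_C g x dg ->
  is_derive_C h x dh ->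
  is_derive_C (fun t => (g t * h t)%C) x
    (dg * h x + g x * dh)%C.
Proof.
  intros Hg Hh.
  pose proof (is_derive_C_fst _ _ _ Hg) as G1. pose proof (is_derive_C_snd _ _ _ Hg) as G2.
  pose proof (is_derive_C_fst _ _ _ Hh) as H1. pose proof (is_derive_C_snd _ _ _ Hh) as H2.
  apply is_derive_C_pair; simpl.
  - evar_last.
    + apply (is_derive_minus (V := R_NormedModule));
        apply (is_derive_mult (K := R_AbsRing)); eauto; intros; apply Rmult_comm.
    + unfold minus, plus, opp, mult; simpl. ring.
  - evar_last.
    + apply (is_derive_plus (V := R_NormedModule));
        apply (is_derive_mult (K := R_AbsRing)); eauto; intros; apply Rmult_comm.
    + unfold minus, plus, opp, mult; simpl. ring.
Qed.

Lemma is_derive_Cinv (g : R -> C) (x : R) (dg : C) :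
  is_derive_C g x dg -> g x <> 0 ->
  is_derive_C (fun t => (/ g t)%C) x (- dg / (g x * g x))%C.
Proof.
  intros Hg Hx.
  pose proof (is_derive_C_fst _ _ _ Hg) as G1. pose proof (is_derive_C_snd _ _ _ Hg) as G2.
  assert (Hn : fst (g x) ^ 2 + snd (g x) ^ 2 <> 0).
  { intros E. apply Hx, Cmod_eq_0. unfold Cmod. rewrite E. apply sqrt_0. }
  assert (Hd : is_derive (fun t => fst (g t) ^ 2 + snd (g t) ^ 2) x
     (2 * fst (g x) * fst dg + 2 * snd (g x) * snd dg)).
  { evar_last.
    + apply (is_derive_plus (V := R_NormedModule)); apply is_derive_pow; eauto.
    + unfold plus; simpl. ring. }
  assert (Hm : (fst (g x) * fst (g x) - snd (g x) * snd (g x)) ^ 2 +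
     (fst (g x) * snd (g x) + snd (g x) * fst (g x)) ^ 2 <> 0).
  { replace (_ + _) with ((fst (g x) ^ 2 + snd (g x) ^ 2) ^ 2) by ring.
    now apply pow_nonzero. }
  apply is_derive_C_pair; simpl.
  - evar_last.
    + apply is_derive_div; eauto.
    + simpl in *. field.
      split; intros E; [apply Hm | apply Hn]; rewrite !Rmult_1_r; exact E.
  - evar_last.
    + apply is_derive_div; eauto. apply (is_derive_opp (V := R_NormedModule)). eauto.
    + unfold opp; simpl in *. field.
      split; intros E; [apply Hm | apply Hn]; rewrite !Rmult_1_r; exact E.
Qed.

Lemma is_derive_C_continuous (g : R -> C) (x : R) (l : C) :
  is_derive_C g x l -> continuous g x.
Proof.
  intros H. apply (ex_derive_continuous (V := C_R_NormedModule)). now exists l.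
Qed.

(** Lets the derivative be computed by the rules first and put in the wanted form
    afterwards. *)
Lemma is_derive_C_eq (g : R -> C) (x : R) (l l' : C) :
  is_derive_C g x l -> l = l' ->
  is_derive_C g x l'.
Proof. now intros H <-. Qed.

Lemma is_derive_C_const (c : C) (x : R) :
  is_derive_C (fun _ => c) x (RtoC 0).
Proof. apply (is_derive_const (V := C_R_NormedModule)). Qed.

Lemma is_derive_Cplus (g h : R -> C) (x : R) (dg dh : C) :
  is_derive_C g x dg ->
  is_derive_C h x dh ->
  is_derive_C (fun t => (g t + h t)%C) x (dg + dh)%C.
Proof. apply (is_derive_plus (V := C_R_NormedModule)). Qed.

Lemma is_derive_Cminus (g h : R -> C) (x : R) (dg dh : C) :
  is_derive_C g x dg ->
  is_derive_C h x dh ->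
  is_derive_C (fun t => (g t - h t)%C) x (dg - dh)%C.
Proof. apply (is_derive_minus (V := C_R_NormedModule)). Qed.

Lemma is_derive_RtoC (x : R) :
  is_derive_C (fun t => RtoC t) x (RtoC 1).
Proof.
  apply is_derive_C_pair; simpl.
  - apply (is_derive_id (K := R_AbsRing)).
  - apply (is_derive_const (V := R_NormedModule)).
Qed.

Definition CInt (g : R -> C) (a b : R) : C := RInt (V := C_R_CompleteNormedModule) g a b.

Lemma is_CInt_pair (g : R -> C) (a b : R) (l : C) :
  is_RInt (V := R_NormedModule) (fun t => fst (g t)) a b (fst l) ->
  is_RInt (V := R_NormedModule) (fun t => snd (g t)) a b (snd l) ->
  is_RInt (V := C_R_NormedModule) g a b l.
Proof.
  intros H1 H2. destruct l.
  now apply (is_RInt_fct_extend_pair (U := R_NormedModule) (V := R_NormedModule)).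
Qed.

Lemma CInt_ext (g h : R -> C) (a b : R) :
  (forall t, g t = h t) -> CInt g a b = CInt h a b.
Proof. intros H. apply (RInt_ext (V := C_R_CompleteNormedModule)). intros t _. apply H. Qed.

Lemma ex_CInt (g : R -> C) (a b : R) :
  (forall t, continuous g t) -> ex_RInt (V := C_R_CompleteNormedModule) g a b.
Proof.
  intros H. apply (ex_RInt_continuous (V := C_R_CompleteNormedModule)). intros; apply H.
Qed.

Lemma is_CInt (g : R -> C) (a b : R) :
  ex_RInt (V := C_R_CompleteNormedModule) g a b ->
  is_RInt (V := C_R_NormedModule) g a b (CInt g a b).
Proof. intros H. apply (RInt_correct (V := C_R_CompleteNormedModule)), H. Qed.

Lemma CInt_unique (g : R -> C) (a b : R) (l : C) :
  is_RInt (V := C_R_NormedModule) g a b l -> CInt g a b = l.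
Proof. apply (is_RInt_unique (V := C_R_CompleteNormedModule)). Qed.

Lemma is_CInt_scal (c : C) (g : R -> C) (a b : R) (l : C) :
  is_RInt (V := C_R_NormedModule) g a b l ->
  is_RInt (V := C_R_NormedModule) (fun t => c * g t)%C a b (c * l)%C.
Proof.
  intros H.
  pose proof (is_RInt_fct_extend_fst (U := R_NormedModule) (V := R_NormedModule)
    _ _ _ _ H) as H1.
  pose proof (is_RInt_fct_extend_snd (U := R_NormedModule) (V := R_NormedModule)
    _ _ _ _ H) as H2.
  apply is_CInt_pair; simpl.
  - apply (is_RInt_minus (V := R_NormedModule)); now apply (is_RInt_scal (V := R_NormedModule)).
  - apply (is_RInt_plus (V := R_NormedModule)); now apply (is_RInt_scal (V := R_NormedModule)).
Qed.

Lemma CInt_scal (c : C) (g : R -> C) (a b : R) :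
  (forall t, continuous g t) -> CInt (fun t => c * g t)%C a b = (c * CInt g a b)%C.
Proof. intros H. apply CInt_unique, is_CInt_scal, is_CInt, ex_CInt, H. Qed.

Lemma CInt_minus (g h : R -> C) (a b : R) :
  (forall t, continuous g t) -> (forall t, continuous h t) ->
  CInt (fun t => g t - h t)%C a b = (CInt g a b - CInt h a b)%C.
Proof.
  intros Hg Hh. apply CInt_unique.
  apply (is_RInt_minus (V := C_R_NormedModule)); now apply is_CInt, ex_CInt.
Qed.

Lemma CInt_derive (g dg : R -> C) (a b : R) :
  (forall t, is_derive_C g t (dg t)) ->
  (forall t, continuous dg t) -> CInt dg a b = (g b - g a)%C.
Proof.
  intros H1 H2. apply CInt_unique.
  apply (is_RInt_derive (V := C_R_CompleteNormedModule)); intros; auto.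
Qed.

Lemma CInt_const_1 (a b : R) : CInt (fun _ => RtoC 1) a b = RtoC (b - a).
Proof.
  rewrite (CInt_derive (fun t => RtoC t)); intros.
  - symmetry. apply RtoC_minus.
  - apply is_derive_RtoC.
  - apply continuous_const.
Qed.

Lemma CInt_bound (g : R -> C) (a b M : R) :
  a <= b -> (forall t, continuous g t) -> (forall t, a <= t <= b -> Cmod (g t) <= M) ->
  Cmod (CInt g a b) <= (b - a) * M.
Proof.
  intros Hab Hc HM. rewrite <- norm_C_R.
  apply (norm_RInt_le_const (V := C_R_NormedModule) g); auto.
  - intros t Ht. rewrite norm_C_R. auto.
  - now apply is_CInt, ex_CInt.
Qed.

Lemma CInt_fst (g : R -> C) (a b : R) :
  (forall t, continuous g t) -> fst (CInt g a b) = RInt (fun t => fst (g t)) a b.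
Proof.
  intros H. symmetry. apply is_RInt_unique.
  apply (is_RInt_fct_extend_fst (U := R_NormedModule) (V := R_NormedModule)).
  now apply is_CInt, ex_CInt.
Qed.

Lemma CInt_snd (g : R -> C) (a b : R) :
  (forall t, continuous g t) -> snd (CInt g a b) = RInt (fun t => snd (g t)) a b.
Proof.
  intros H. symmetry. apply is_RInt_unique.
  apply (is_RInt_fct_extend_snd (U := R_NormedModule) (V := R_NormedModule)).
  now apply is_CInt, ex_CInt.
Qed.

Lemma is_derive_RInt_param_loc (h dh : R -> R -> R) (a b x : R) (d : posreal) :
  (forall y t, Rabs (y - x) < d -> is_derive (fun u => h u t) y (dh y t)) ->
  (forall t, continuity_2d_pt dh x t) ->
  (forall y t, Rabs (y - x) < d -> continuous (h y) t) ->
  is_derive (fun u => RInt (h u) a b) x (RInt (dh x) a b).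
Proof.
  intros H1 H2 H3.
  replace (RInt (dh x) a b) with (RInt (fun t => Derive (fun u => h u t) x) a b).
  2: { apply RInt_ext. intros t _. apply is_derive_unique, H1.
       rewrite Rminus_diag, Rabs_R0. apply cond_pos. }
  apply (is_derive_RInt_param h).
  - exists d. intros y Hy t _. exists (dh y t). now apply H1.
  - intros t _. apply continuity_2d_pt_ext_loc with (2 := H2 t).
    exists d. intros u v Hu _. symmetry. now apply is_derive_unique, H1.
  - exists d. intros y Hy. apply (ex_RInt_continuous (V := R_CompleteNormedModule)).
    intros t _. now apply H3.
Qed.

(** Differentiation under the integral sign. The parameter derivative is assumed
    for all [t], and not only between [a] and [b], because the real theorem asks for
    continuity in two variables at the end points as well. *)
Lemma is_derive_CInt (h dh : R -> R -> C) (a b x : R) (d : posreal) :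
  (forall y t, Rabs (y - x) < d ->
     is_derive_C (fun u => h u t) y (dh y t)) ->
  (forall t, continuous (fun p : R * R => dh (fst p) (snd p)) (x, t)) ->
  (forall y t, Rabs (y - x) < d -> continuous (h y) t) ->
  is_derive_C (fun u => CInt (h u) a b) x (CInt (dh x) a b).
Proof.
  intros H1 H2 H3.
  assert (Hc : forall t, continuous (dh x) t).
  { intros t.
    apply (continuous_comp (fun t => (x, t)) (fun p : R * R => dh (fst p) (snd p))); [|apply H2].
    apply (continuous_comp_2 (fun _ => x) (fun t => t) (fun a b : R => (a, b)));
      [apply continuous_const | apply continuous_id |].
    apply continuous_ext with (fun p : R * R => p); [now intros [] | apply continuous_id]. }
  assert (L : forall y, ball x d y -> forall t, continuous (h y) t) by (intros; now apply H3).
  apply is_derive_C_pair.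
  - rewrite CInt_fst by exact Hc.
    apply is_derive_ext_loc with (fun u => RInt (fun t => fst (h u t)) a b).
    { exists d. intros y Hy. symmetry. apply CInt_fst. now apply L. }
    apply (is_derive_RInt_param_loc (fun u t => fst (h u t)) (fun u t => fst (dh u t)) a b x d).
    + intros; now apply is_derive_C_fst, H1.
    + intros t. apply continuity_2d_pt_filterlim. apply (continuous_C_fst _ _ (H2 t)).
    + intros; now apply continuous_C_fst, H3.
  - rewrite CInt_snd by exact Hc.
    apply is_derive_ext_loc with (fun u => RInt (fun t => snd (h u t)) a b).
    { exists d. intros y Hy. symmetry. apply CInt_snd. now apply L. }
    apply (is_derive_RInt_param_loc (fun u t => snd (h u t)) (fun u t => snd (dh u t)) a b x d).
    + intros; now apply is_derive_C_snd, H1.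
    + intros t. apply continuity_2d_pt_filterlim. apply (continuous_C_snd _ _ (H2 t)).
    + intros; now apply continuous_C_snd, H3.
Qed.

(** * The primitive of a Morera-holomorphic function on the disc *)

Lemma unit_disc_open (z : C) : unit_disc z -> locally z unit_disc.
Proof.
  intros Hz. apply locally_Cmod.
  assert (Hd : 0 < 1 - Cmod z) by (unfold unit_disc in Hz; lra).
  exists (mkposreal _ Hd). simpl. intros y Hy. unfold unit_disc.
  replace y with (z + (y - z))%C by ring.
  eapply Rle_lt_trans; [apply Cmod_triangle | lra].
Qed.

Lemma continuous_on_disc (f : C -> C) (z : C) :
  continuous_on unit_disc f -> unit_disc z -> continuous f z.
Proof.
  intros H Hz P HP. specialize (H z Hz P HP).
  unfold filtermap, within in *.
  generalize (filter_and _ _ H (unit_disc_open z Hz)). apply filter_imp.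
  intros x [Hx Hd]. exact (Hx Hd).
Qed.

Lemma unit_disc_convex (a b : C) (t : R) :
  unit_disc a -> unit_disc b -> 0 <= t <= 1 -> unit_disc (a + t * (b - a))%C.
Proof.
  unfold unit_disc. intros Ha Hb Ht.
  replace (a + t * (b - a))%C with (RtoC (1 - t) * a + RtoC t * b)%C
    by (rewrite RtoC_minus; ring).
  eapply Rle_lt_trans; [apply Cmod_triangle |].
  rewrite !Cmod_mult, !Cmod_R, !Rabs_pos_eq by lra.
  destruct (Rle_lt_dec t (/ 2)); nra.
Qed.

Lemma unit_disc_line (p u : C) (x y s : R) :
  unit_disc (p + x * u)%C -> unit_disc (p + y * u)%C ->
  Rmin x y <= s <= Rmax x y -> unit_disc (p + s * u)%C.
Proof.
  intros Hx Hy Hs.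
  destruct (Req_dec x y) as [E | E].
  { subst y. unfold Rmin, Rmax in Hs. destruct (Rle_dec x x);
    replace s with x by lra; exact Hx. }
  replace (p + s * u)%C with
    (p + x * u + RtoC ((s - x) / (y - x)) * ((p + y * u) - (p + x * u)))%C.
  - apply unit_disc_convex; auto.
    unfold Rmin, Rmax in Hs. destruct (Rle_dec x y).
    + assert (H : 0 < y - x) by lra. split.
      * apply Rdiv_le_0_compat; lra.
      * apply Rle_div_l; lra.
    + assert (H : 0 < x - y) by lra.
      replace ((s - x) / (y - x)) with ((x - s) / (x - y)) by (field; lra). split.
      * apply Rdiv_le_0_compat; lra.
      * apply Rle_div_l; lra.
  - apply injective_projections; simpl; field; lra.
Qed.

Lemma unit_disc_triangle (a b c z : C) :
  unit_disc a -> unit_disc b -> unit_disc c -> closed_triangle a b c z ->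
  unit_disc z.
Proof.
  unfold unit_disc. intros Ha Hb Hc (s & t & u & Hs & Ht & Hu & E & ->).
  eapply Rle_lt_trans; [apply Cmod_triangle |].
  eapply Rle_lt_trans; [apply Rplus_le_compat_r, Cmod_triangle |].
  rewrite !Cmod_mult, !Cmod_R, !Rabs_pos_eq by lra.
  set (m := Rmax (Cmod a) (Rmax (Cmod b) (Cmod c))).
  assert (Cmod a <= m) by apply Rmax_l.
  assert (Cmod b <= m) by (eapply Rle_trans; [apply Rmax_l | apply Rmax_r]).
  assert (Cmod c <= m) by (eapply Rle_trans; [apply Rmax_r | apply Rmax_r]).
  assert (m < 1) by (repeat apply Rmax_lub_lt; assumption).
  apply Rle_lt_trans with ((s + t + u) * m); [nra | rewrite E; lra].
Qed.

Section Primitive.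
Context (f : C -> C) (Hf : morera_holomorphic unit_disc f).

Lemma morera_continuous (z : C) : unit_disc z -> continuous f z.
Proof. apply continuous_on_disc, Hf. Qed.

Lemma ex_RInt_line (p u : C) (x y : R) :
  unit_disc (p + x * u)%C -> unit_disc (p + y * u)%C ->
  ex_RInt (V := C_R_CompleteNormedModule) (fun s : R => f (p + s * u) * u)%C x y.
Proof.
  intros Hx Hy. apply (ex_RInt_continuous (V := C_R_CompleteNormedModule)).
  intros s Hs. apply (continuous_Cmult (U := R_UniformSpace)); [| apply continuous_const].
  apply (continuous_comp (fun s : R => (p + s * u)%C) f).
  - apply continuous_Cplus; [apply continuous_const |].
    apply continuous_Cmult; [| apply continuous_const].
    apply continuous_RtoC, continuous_id.
  - apply morera_continuous. now apply unit_disc_line with x y.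
Qed.

(** A segment inside a line parametrized once and for all: this reduces the
    reversal of a segment, and the case of collinear points, to the calculus of
    integrals over real intervals. *)
Lemma segment_integral_line (p u : C) (x y : R) :
  unit_disc (p + x * u)%C -> unit_disc (p + y * u)%C ->
  segment_integral f (p + x * u) (p + y * u) = CInt (fun s : R => f (p + s * u) * u)%C x y.
Proof.
  intros Hx Hy. unfold segment_integral, CInt.
  transitivity (RInt (V := C_R_CompleteNormedModule)
    (fun s : R => f (p + s * u) * u)%C ((y - x) * 0 + x) ((y - x) * 1 + x)).
  2: f_equal; ring.
  rewrite <- RInt_comp_lin.
  - apply (RInt_ext (V := C_R_CompleteNormedModule)). intros t _.
    replace (p + ((y - x) * t + x)%R * u)%C with (p + x * u + t * (p + y * u - (p + x * u)))%C.
    + apply injective_projections; simpl; unfold scal; simpl; unfold mult; simpl; ring.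
    + apply injective_projections; simpl; ring.
  - replace ((y - x) * 0 + x) with x by ring.
    replace ((y - x) * 1 + x) with y by ring.
    now apply ex_RInt_line.
Qed.

Lemma segment_integral_swap (a b : C) :
  unit_disc a -> unit_disc b -> segment_integral f b a = (- segment_integral f a b)%C.
Proof.
  intros Ha Hb.
  pose proof (segment_integral_line a (b - a) 0 1) as H1.
  pose proof (segment_integral_line a (b - a) 1 0) as H2.
  pose proof (ex_RInt_line a (b - a) 0 1) as H3.
  replace (a + RtoC 0 * (b - a))%C with a in * by ring.
  replace (a + RtoC 1 * (b - a))%C with b in * by ring.
  rewrite H1, H2 by assumption. symmetry.
  apply (opp_RInt_swap (V := C_R_CompleteNormedModule)). now apply H3.
Qed.

Definition disc_primitive (z : C) : C := segment_integral f 0 z.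

Lemma unit_disc_0 : unit_disc 0.
Proof. unfold unit_disc. rewrite Cmod_0. lra. Qed.

Lemma primitive_minus_collinear (u : C) (x y : R) :
  unit_disc (x * u)%C -> unit_disc (y * u)%C ->
  (disc_primitive (y * u) - disc_primitive (x * u))%C = segment_integral f (x * u) (y * u).
Proof.
  intros Hx Hy.
  assert (H0 := unit_disc_0).
  unfold disc_primitive.
  replace (x * u)%C with (0 + x * u)%C in * by ring.
  replace (y * u)%C with (0 + y * u)%C in * by ring.
  assert (E : RtoC 0 = (0 + 0%R * u)%C) by ring.
  pose proof H0 as H0'. rewrite E in H0'.
  pose proof (ex_RInt_line 0 u 0 x H0' Hx) as I1.
  pose proof (ex_RInt_line 0 u x y Hx Hy) as I2.
  pose proof (segment_integral_line 0 u 0 x H0' Hx) as E1.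
  pose proof (segment_integral_line 0 u 0 y H0' Hy) as E2.
  rewrite <- E in E1, E2. rewrite E1, E2.
  rewrite segment_integral_line by assumption.
  unfold CInt. rewrite <- (RInt_Chasles (V := C_R_CompleteNormedModule) _ _ _ _ I1 I2).
  change (@plus C_R_CompleteNormedModule) with Cplus. ring.
Qed.

(** The triangle with vertices [0], [a], [b] is counterclockwise, clockwise or flat,
    according to the sign of its area. The hypothesis on [f] covers the first case,
    and the second after exchanging [a] and [b]. In the flat case it says nothing, but
    the three segments lie on one line. *)
Lemma primitive_minus (a b : C) :
  unit_disc a -> unit_disc b ->
  (disc_primitive b - disc_primitive a)%C = segment_integral f a b.
Proof.
  intros Ha Hb. assert (H0 := unit_disc_0).
  destruct (Rtotal_order 0 (Im (Cconj a * b))) as [H | [H | H]].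
  - assert (T : triangle_integral f 0 a b = 0).
    { apply Hf.
      - unfold counterclockwise. now replace (Cconj (a - 0) * (b - 0))%C with (Cconj a * b)%C
          by (apply injective_projections; simpl; ring).
      - intros z. now apply unit_disc_triangle. }
    unfold triangle_integral in T. rewrite (segment_integral_swap 0 b) in T by assumption.
    unfold disc_primitive.
    replace (segment_integral f a b) with
      (segment_integral f 0 a + segment_integral f a b + - segment_integral f 0 b
       + segment_integral f 0 b - segment_integral f 0 a)%C by ring.
    rewrite T. ring.
  - destruct (Ceq_dec a 0) as [-> | Ha0].
    + pose proof (primitive_minus_collinear b 0 1) as P.
      replace (RtoC 0 * b)%C with (RtoC 0) in P by ring.
      replace (RtoC 1 * b)%C with b in P by ring. now apply P.
    + pose proof (primitive_minus_collinear a 1 (Re (Cconj a * b) / (Cmod a ^ 2))) as P.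
      replace (RtoC 1 * a)%C with a in P by ring.
      replace (RtoC (Re (Cconj a * b) / Cmod a ^ 2) * a)%C with b in P.
      { now apply P. }
      assert (Hm : Cmod a ^ 2 <> 0) by (apply pow_nonzero, Rgt_not_eq, Cmod_gt_0, Ha0).
      rewrite Cmod2_alt in *. destruct a as [a1 a2], b as [b1 b2]. simpl in *.
      assert (H' : a1 * b2 = a2 * b1) by lra.
      apply injective_projections; simpl.
      * apply Rmult_eq_reg_r with (2 := Hm).
        transitivity ((a1 * b1 + a2 * b2) * a1);
          [| field; contradict Hm; rewrite !Rmult_1_r; exact Hm].
        replace ((a1 * b1 + a2 * b2) * a1) with (a1 * a1 * b1 + a2 * (a1 * b2)) by ring.
        rewrite H'. ring.
      * apply Rmult_eq_reg_r with (2 := Hm).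
        transitivity ((a1 * b1 + a2 * b2) * a2);
          [| field; contradict Hm; rewrite !Rmult_1_r; exact Hm].
        replace ((a1 * b1 + a2 * b2) * a2) with (a1 * (a2 * b1) + a2 * a2 * b2) by ring.
        rewrite <- H'. ring.
  - assert (T : triangle_integral f 0 b a = 0).
    { apply Hf.
      - unfold counterclockwise. replace (Cconj (b - 0) * (a - 0))%C with (Cconj (Cconj a * b))%C
          by (apply injective_projections; simpl; ring). simpl in *. lra.
      - intros z. now apply unit_disc_triangle. }
    unfold triangle_integral in T.
    rewrite (segment_integral_swap 0 a), (segment_integral_swap a b) in T by assumption.
    unfold disc_primitive.
    replace (segment_integral f a b) with
      (segment_integral f 0 b - segment_integral f 0 a
       - (segment_integral f 0 b + - segment_integral f a b + - segment_integral f 0 a))%C by ring.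
    rewrite T. ring.
Qed.

Lemma segment_integral_approx (a b : C) (e : R) :
  unit_disc a -> unit_disc b ->
  (forall t : R, 0 <= t <= 1 -> Cmod (f (a + t * (b - a)) - f a) <= e) ->
  Cmod (segment_integral f a b - f a * (b - a)) <= e * Cmod (b - a).
Proof.
  intros Ha Hb He.
  rewrite <- norm_C_R.
  replace (e * Cmod (b - a)) with ((1 - 0) * (e * Cmod (b - a))) by ring.
  apply (norm_RInt_le_const (V := C_R_NormedModule)
    (fun t : R => (f (a + t * (b - a)) * (b - a) - f a * (b - a))%C)); [lra | |].
  - intros t Ht. rewrite norm_C_R.
    replace (_ - _)%C with ((f (a + t * (b - a)) - f a) * (b - a))%C by ring.
    rewrite Cmod_mult. apply Rmult_le_compat_r; [apply Cmod_ge_0 | auto].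
  - apply (is_RInt_minus (V := C_R_NormedModule)).
    + apply (RInt_correct (V := C_R_CompleteNormedModule)).
      apply ex_RInt_line.
      * now replace (a + RtoC 0 * (b - a))%C with a by ring.
      * now replace (a + RtoC 1 * (b - a))%C with b by ring.
    + pose proof (is_RInt_const (V := C_R_NormedModule) 0 1 (f a * (b - a))%C) as H.
      rewrite Rminus_0_r in H.
      replace (f a * (b - a))%C with (scal (V := C_R_NormedModule) 1 (f a * (b - a))%C)
        at 1 by apply (scal_one (V := C_R_NormedModule)).
      exact H.
Qed.

(** Complex differentiability of the primitive, in the form of a real differential
    that is multiplication by [f z]. This form composes with curves, whose scalar
    field is [R]. *)
Lemma primitive_filterdiff (z : C) : unit_disc z ->
  filterdiff (U := C_R_NormedModule) (V := C_R_NormedModule)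
    disc_primitive (locally z) (fun h => (h * f z)%C).
Proof.
  intros Hz. split.
  - split.
    + intros x y. change ((x + y) * f z = x * f z + y * f z)%C. ring.
    + intros k x. apply injective_projections; simpl; unfold scal; simpl; unfold mult; simpl; ring.
    + exists (Cmod (f z) + 1). split; [pose proof (Cmod_ge_0 (f z)); lra |].
      intros x. rewrite !norm_C_R, Cmod_mult.
      pose proof (Cmod_ge_0 x). nra.
  - intros x Hx.
    apply (is_filter_lim_locally_unique (K := R_AbsRing) (V := C_R_NormedModule)) in Hx.
    subst x.
    intros e.
    pose proof (morera_continuous z Hz) as Hc.
    assert (L : locally z (fun y => Cmod (f y - f z) < e)).
    { apply (Hc (fun w => Cmod (w - f z) < e)). apply locally_Cmod. now exists e. }
    apply locally_Cmod in L. destruct L as [d Hd].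
    pose proof (unit_disc_open z Hz) as D. apply locally_Cmod in D. destruct D as [d' Hd'].
    apply locally_Cmod. exists (mkposreal _ (Rmin_stable_in_posreal d d')). simpl.
    intros y Hy. rewrite !norm_C_R.
    change (@minus C_R_NormedModule) with Cminus.
    assert (Hyd : unit_disc y) by (apply Hd'; eapply Rlt_le_trans; [exact Hy | apply Rmin_r]).
    rewrite primitive_minus by assumption. rewrite (Cmult_comm (y - z)).
    apply segment_integral_approx; auto.
    intros t Ht. left. apply Hd.
    replace (z + t * (y - z) - z)%C with (RtoC t * (y - z))%C by ring.
    rewrite Cmod_mult, Cmod_R, Rabs_pos_eq by lra.
    apply Rle_lt_trans with (Cmod (y - z)).
    + pose proof (Cmod_ge_0 (y - z)). nra.
    + eapply Rlt_le_trans; [exact Hy | apply Rmin_l].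
Qed.

Lemma primitive_chain (g : R -> C) (x : R) (l : C) :
  is_derive_C g x l -> unit_disc (g x) ->
  is_derive_C (fun t => disc_primitive (g t)) x (l * f (g x))%C.
Proof.
  intros Hg Hx. unfold is_derive in *.
  eapply filterdiff_ext_lin.
  - apply (filterdiff_comp' (V := C_R_NormedModule) (W := C_R_NormedModule) g disc_primitive x _
             (fun h => (h * f (g x))%C) Hg).
    apply primitive_filterdiff, Hx.
  - intros y. apply injective_projections; simpl; unfold scal; simpl; unfold mult; simpl; ring.
Qed.

Lemma primitive_continuous (z : C) : unit_disc z -> continuous disc_primitive z.
Proof.
  intros Hz.
  apply (filterdiff_continuous (K := R_AbsRing)
    (U := C_R_NormedModule) (V := C_R_NormedModule)).
  eexists. now apply primitive_filterdiff.
Qed.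

End Primitive.

(** * Cauchy's formula for the derivative *)

Definition circle (r t : R) : C := (r * cos t, r * sin t).

Lemma Cmod_circle (r t : R) : 0 <= r -> Cmod (circle r t) = r.
Proof.
  intros Hr. unfold Cmod, circle; simpl.
  replace (_ + _) with (r ^ 2 * ((sin t)² + (cos t)²)) by (unfold Rsqr; ring).
  rewrite sin2_cos2, Rmult_1_r. now apply sqrt_pow2.
Qed.

Lemma circle_2PI (r : R) : circle r (2 * PI) = circle r 0.
Proof. unfold circle. now rewrite cos_2PI, sin_2PI, cos_0, sin_0. Qed.

Lemma is_derive_circle (r t : R) :
  is_derive_C (circle r) t (Ci * circle r t)%C.
Proof. apply is_derive_C_pair; simpl; auto_derive; auto; ring. Qed.

Lemma continuous_circle (r t : R) : continuous (circle r) t.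
Proof. eapply is_derive_C_continuous, is_derive_circle. Qed.

Lemma circle_neq (r t : R) (z : C) : Cmod z < r -> (circle r t - z)%C <> 0.
Proof.
  intros Hz E.
  assert (circle r t = z) by (replace z with (0 + z)%C by ring; rewrite <- E; ring).
  pose proof (Cmod_ge_0 z). subst z. rewrite Cmod_circle in *; lra.
Qed.

Lemma circle_minus_lower (r t s : R) (z : C) :
  Cmod z <= s -> s < r -> r - s <= Cmod (circle r t - z).
Proof.
  intros Hz Hs. pose proof (Cmod_ge_0 z).
  pose proof (Cmod_triangle (circle r t - z) z) as T.
  replace (circle r t - z + z)%C with (circle r t) in T by ring.
  rewrite Cmod_circle in T; lra.
Qed.

(** Decomposes a continuity goal along the field operations of [C]. Division is
    multiplication by the inverse; what remains are the nonvanishing conditions. *)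
Ltac ccont :=
  repeat lazymatch goal with
  | |- continuous (fun _ => Cplus _ _) _ => apply continuous_Cplus
  | |- continuous (fun _ => Cminus _ _) _ => apply continuous_Cminus
  | |- continuous (fun _ => Cdiv _ _) _ => apply continuous_Cmult
  | |- continuous (fun _ => Cmult _ _) _ => apply continuous_Cmult
  | |- continuous (fun _ => Cpow _ _) _ => apply continuous_Cpow
  | |- continuous (fun _ => Cinv _) _ => apply continuous_Cinv
  | |- continuous (fun _ => RtoC _) _ => apply continuous_RtoC
  | |- continuous (fun _ => circle _ (snd _)) _ =>
      apply (continuous_comp snd); [apply continuous_snd | apply continuous_circle]
  | |- continuous (fun _ => circle _ _) _ => apply continuous_circle
  | |- continuous (circle _) _ => apply continuous_circle
  | |- continuous (fun x => x) _ => apply continuous_id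
  | |- continuous fst _ => apply continuous_fst
  | |- continuous (fun _ => _) _ => apply continuous_const
  end.


(** Differentiating along the circle produces the factor [Ci * w]; another factor [Ci]
    in the antiderivatives cancels it through this identity. *)
Lemma Ci_mult (z : C) : (Ci * (Ci * z))%C = (- z)%C.
Proof. apply injective_projections; simpl; ring. Qed.

(** With [s * z] in place of [z] the integral does not depend on [s], because the
    [s]-derivative of the integrand is the [t]-derivative of the periodic function
    [Ci * z / (w - s * z)]. At [s = 0] the integrand is 1. *)
Lemma cauchy_kernel_integral (r : R) (z : C) :
  Cmod z < r ->
  CInt (fun t => circle r t / (circle r t - z))%C 0 (2 * PI) = RtoC (2 * PI).
Proof.
  intros Hz. pose proof (Cmod_ge_0 z) as Hz0.
  set (J := fun s : R => CInt (fun t => circle r t / (circle r t - s * z))%C 0 (2 * PI)).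
  assert (Hd : 0 < (r - Cmod z) / (Cmod z + 1)) by (apply Rdiv_lt_0_compat; lra).
  set (d := mkposreal _ Hd).
  assert (Hsz : forall s y, 0 <= s <= 1 -> Rabs (y - s) < d -> Cmod (y * z) < r).
  { intros s y Hs Hy. rewrite Cmod_mult, Cmod_R.
    assert (Rabs y <= 1 + d).
    { revert Hy. unfold Rabs; repeat destruct Rcase_abs; pose proof (cond_pos d); lra. }
    assert (d * (Cmod z + 1) = r - Cmod z) by (simpl; field; lra).
    pose proof (cond_pos d). nra. }
  assert (D : forall s, 0 <= s <= 1 -> is_derive_C J s (RtoC 0)).
  { intros s Hs.
    assert (N : forall y t, Rabs (y - s) < d -> (circle r t - y * z)%C <> 0).
    { intros y t Hy. apply circle_neq. now apply Hsz with s. }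
    assert (Ns : forall t, (circle r t - s * z)%C <> 0).
    { intros t. apply N. rewrite Rminus_diag, Rabs_R0. apply cond_pos. }
    replace (RtoC 0) with
      (CInt (fun t => circle r t * z / ((circle r t - s * z) * (circle r t - s * z)))%C 0 (2 * PI)).
    - apply (is_derive_CInt (fun s t => circle r t / (circle r t - s * z))%C
        (fun s t => circle r t * z / ((circle r t - s * z) * (circle r t - s * z)))%C
        0 (2 * PI) s d).
      + intros y t Hy. specialize (N y t Hy). unfold Cdiv.
        eapply is_derive_C_eq.
        * apply is_derive_Cmult; [apply is_derive_C_const |].
          apply is_derive_Cinv; [| exact N].
          apply is_derive_Cminus; [apply is_derive_C_const |].
          apply is_derive_Cmult; [apply is_derive_RtoC | apply is_derive_C_const].
        * cbv beta. field. exact N.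
      + intros t. ccont. now apply Cmult_neq_0.
      + intros y t Hy. ccont. now apply N.
    - rewrite (CInt_derive (fun t => Ci * z / (circle r t - s * z))%C).
      + rewrite circle_2PI. ring.
      + intros t. specialize (Ns t). unfold Cdiv.
        eapply is_derive_C_eq.
        * apply is_derive_Cmult; [apply is_derive_C_const |].
          apply is_derive_Cinv; [| exact Ns].
          apply is_derive_Cminus; [apply is_derive_circle | apply is_derive_C_const].
        * transitivity (- (Ci * (Ci * circle r t)) * z *
            / ((circle r t - s * z) * (circle r t - s * z)))%C; [field; exact Ns |].
          rewrite Ci_mult. field. exact Ns.
      + intros t. ccont. now apply Cmult_neq_0. }
  transitivity (J 1).
  { apply CInt_ext. intros t. now replace (1 * z)%C with z by ring. }
  rewrite <- (eq_is_derive (V := C_R_NormedModule) J 0 1 D Rlt_0_1).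
  transitivity (CInt (fun t => RtoC 1) 0 (2 * PI)).
  - apply CInt_ext. intros t.
    assert (N : circle r t <> 0).
    { replace (circle r t) with (circle r t - 0)%C by ring.
      apply circle_neq. rewrite Cmod_0. lra. }
    replace (circle r t - 0 * z)%C with (circle r t) by ring. now field.
  - rewrite CInt_const_1. f_equal. ring.
Qed.

Section Cauchy.
Context (F f : C -> C).
Context (f_cont : forall z, unit_disc z -> continuous f z).
Context (F_cont : forall z, unit_disc z -> continuous F z).
Context (F_chain : forall (g : R -> C) (x : R) (l : C),
  is_derive_C g x l -> unit_disc (g x) ->
  is_derive_C (fun t => F (g t)) x (l * f (g x))%C).

(** Differentiating in the parameter at the end points 0 and 1 needs a margin beyond
    [0, 1], which [r < 1] provides. *)
Lemma homotopy_in_disc (r s y t : R) (z : C) :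
  Cmod z < r -> r < 1 -> 0 <= s <= 1 -> Rabs (y - s) < (1 - r) / 2 ->
  unit_disc (z + y * (circle r t - z))%C.
Proof.
  intros Hz Hr Hs Hy. pose proof (Cmod_ge_0 z). unfold unit_disc.
  replace (z + y * (circle r t - z))%C with
    (RtoC (1 - s) * z + RtoC s * circle r t + RtoC (y - s) * (circle r t - z))%C
    by (rewrite !RtoC_minus; ring).
  eapply Rle_lt_trans; [apply Cmod_triangle |].
  eapply Rle_lt_trans; [apply Rplus_le_compat_r, Cmod_triangle |].
  rewrite !Cmod_mult, !Cmod_R, Cmod_circle, !Rabs_pos_eq by lra.
  assert (Cmod (circle r t - z) <= 2).
  { eapply Rle_trans; [apply Cmod_triangle |]. rewrite Cmod_opp, Cmod_circle; lra. }
  pose proof (Rabs_pos (y - s)). pose proof (Cmod_ge_0 (circle r t - z)). nra.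
Qed.

(** The identity is only known on one side of 0, hence the comparison with a
    difference quotient at a positive increment. *)
Lemma derive_at_0_of_linear (g : R -> R) (c k : R) :
  (forall s, 0 < s <= 1 -> g s = s * c) -> g 0 = 0 -> is_derive g 0 k -> c = k.
Proof.
  intros Hg Hg0 Hk. apply is_derive_Reals in Hk.
  destruct (Req_dec c k) as [| Hne]; auto. exfalso.
  assert (He : 0 < Rabs (c - k)) by (apply Rabs_pos_lt; lra).
  destruct (Hk _ He) as [e Hk'].
  set (h := Rmin (e / 2) 1).
  assert (Hh : 0 < h <= 1).
  { split; [apply Rmin_glb_lt; pose proof (cond_pos e); lra | apply Rmin_r]. }
  assert (He' : Rabs h < e).
  { rewrite Rabs_pos_eq by lra. apply Rle_lt_trans with (1 := Rmin_l _ _).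
    pose proof (cond_pos e); lra. }
  specialize (Hk' h ltac:(lra) He').
  rewrite Rplus_0_l, Hg0, Hg in Hk' by exact Hh.
  replace ((h * c - 0) / h - k) with (c - k) in Hk' by (field; lra). lra.
Qed.

(** Contracting the circle to [z], with parameter [s]: [G] is the integral on the left
    for the contracted curve, and [K] that of its [s]-derivative. The exponent 2 in the
    kernel makes [G] linear in [s], so that its value at 1 is its derivative at 0,
    which involves [f z] only. *)
Lemma cauchy_formula (r : R) (z : C) :
  Cmod z < r -> r < 1 ->
  CInt (fun t => F (circle r t) *
    (circle r t / ((circle r t - z) * (circle r t - z))))%C 0 (2 * PI)
  = (RtoC (2 * PI) * f z)%C.
Proof.
  intros Hz Hr.
  set (w := circle r).
  set (G := fun s => CInt (fun t => F (z + s * (w t - z)) *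
     (w t / ((w t - z) * (w t - z))))%C 0 (2 * PI)).
  set (K := fun s => CInt (fun t => f (z + s * (w t - z)) *
     (w t / (w t - z)))%C 0 (2 * PI)).
  assert (Hd : 0 < (1 - r) / 2) by lra. set (d := mkposreal _ Hd).
  assert (N : forall t, (w t - z)%C <> 0) by (intros; now apply circle_neq).
  assert (Din : forall s y t, 0 <= s <= 1 -> Rabs (y - s) < d ->
     unit_disc (z + y * (w t - z))%C) by (intros; now apply homotopy_in_disc with s).
  assert (Ds : forall s t, 0 <= s <= 1 -> unit_disc (z + s * (w t - z))%C).
  { intros s t Hs. apply Din with s; auto. rewrite Rminus_diag, Rabs_R0. apply cond_pos. }
  assert (Hw : forall t, continuous w t) by (intros; apply continuous_circle).
  assert (HG : forall s, 0 <= s <= 1 -> is_derive_C G s (K s)).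
  { intros s Hs.
    apply (is_derive_CInt (fun s t => F (z + s * (w t - z)) * (w t / ((w t - z) * (w t - z))))%C
       (fun s t => f (z + s * (w t - z)) * (w t / (w t - z)))%C 0 (2 * PI) s d).
    - intros y t Hy. eapply is_derive_C_eq.
      + apply is_derive_Cmult; [| apply is_derive_C_const].
        apply F_chain; [| now apply Din with s].
        apply is_derive_Cplus; [apply is_derive_C_const |].
        apply is_derive_Cmult; [apply is_derive_RtoC | apply is_derive_C_const].
      + cbv beta. field. apply N.
    - intros t. unfold w. apply continuous_Cmult.
      + apply (continuous_comp (fun p : R * R => z + fst p * (circle r (snd p) - z))%C f).
        * ccont.
        * now apply f_cont, Ds.
      + ccont. apply N.
    - intros y t Hy. unfold w. apply continuous_Cmult.
      + apply (continuous_comp (fun t => z + y * (circle r t - z))%C F).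
        * ccont.
        * now apply F_cont, Din with s.
      + ccont. now apply Cmult_neq_0. }
  assert (HK : forall s, 0 <= s <= 1 -> (s * K s)%C = G s).
  { intros s Hs.
    assert (C1 : forall t, continuous (fun t => f (z + s * (w t - z)) * (w t / (w t - z)))%C t).
    { intros t. unfold w. apply continuous_Cmult.
      - apply (continuous_comp (fun t => z + s * (circle r t - z))%C f); [ccont | now apply f_cont, Ds].
      - ccont. apply N. }
    assert (C2 : forall t, continuous
      (fun t => F (z + s * (w t - z)) * (w t / ((w t - z) * (w t - z))))%C t).
    { intros t. unfold w. apply continuous_Cmult.
      - apply (continuous_comp (fun t => z + s * (circle r t - z))%C F); [ccont | now apply F_cont, Ds].
      - ccont. now apply Cmult_neq_0. }
    assert (E : (RtoC s * K s - G s)%C = 0).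
    { unfold K, G. rewrite <- CInt_scal by exact C1.
      rewrite <- CInt_minus; [| | exact C2].
      2: { intros t. apply continuous_Cmult; [apply continuous_const | apply C1]. }
      (* [s * K s - G s] integrates the derivative of a periodic function. *)
      rewrite (CInt_derive (fun t => - Ci * (F (z + s * (w t - z)) * / (w t - z)))%C).
      - unfold w. rewrite circle_2PI. ring.
      - intros t. eapply is_derive_C_eq.
        + apply is_derive_Cmult; [apply is_derive_C_const |].
          apply is_derive_Cmult.
          * apply F_chain; [| now apply Ds].
            apply is_derive_Cplus; [apply is_derive_C_const |].
            apply is_derive_Cmult; [apply is_derive_C_const |].
            apply is_derive_Cminus; [apply is_derive_circle | apply is_derive_C_const].
          * apply is_derive_Cinv; [| apply N].
            apply is_derive_Cminus; [apply is_derive_circle | apply is_derive_C_const].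
        + fold w.
          transitivity (- (Ci * (Ci * w t)) * (s * f (z + s * (w t - z)) / (w t - z)
             - F (z + s * (w t - z)) / ((w t - z) * (w t - z))))%C; [field; apply N |].
          rewrite Ci_mult. field. apply N.
      - intros t. apply continuous_Cminus; [| apply C2].
        apply continuous_Cmult; [apply continuous_const | apply C1]. }
    replace (G s) with (RtoC s * K s - (RtoC s * K s - G s))%C by ring. rewrite E. ring. }
  (* The derivative of [G s / s] is [(s * K s - G s) / s ^ 2], which is 0. *)
  assert (HGlin : forall s, 0 < s <= 1 -> G s = (s * G 1)%C).
  { intros s Hs.
    assert (E : (/ s * G s)%C = (/ 1 * G 1)%C).
    { destruct (Req_dec s 1) as [-> | Hs1]; [reflexivity |].
      apply (eq_is_derive (V := C_R_NormedModule) (fun s => / s * G s)%C); [| lra].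
      intros u Hu. assert (Nu : RtoC u <> 0) by (intros X; apply RtoC_inj in X; lra).
      eapply is_derive_C_eq.
      - apply is_derive_Cmult; [apply is_derive_Cinv; [apply is_derive_RtoC | exact Nu] |].
        apply HG. lra.
      - cbv beta. rewrite <- HK by lra. match goal with |- _ = ?x => change x with (RtoC 0) end.
        field. exact Nu. }
    assert (Ns : RtoC s <> 0) by (intros X; apply RtoC_inj in X; lra).
    replace (G s) with (s * (/ s * G s))%C by (field; exact Ns).
    rewrite E. field. }
  assert (E0 : G 0 = 0).
  { rewrite <- HK by lra. ring. }
  assert (E1 : G 1 = K 0).
  { pose proof (HG 0 ltac:(lra)) as D0.
    apply injective_projections.
    - apply (derive_at_0_of_linear (fun s => fst (G s)));
        [| now rewrite E0 | now apply is_derive_C_fst].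
      intros s Hs. rewrite HGlin by exact Hs. simpl. ring.
    - apply (derive_at_0_of_linear (fun s => snd (G s)));
        [| now rewrite E0 | now apply is_derive_C_snd].
      intros s Hs. rewrite HGlin by exact Hs. simpl. ring. }
  transitivity (G 1).
  { apply CInt_ext. intros t. now replace (z + 1 * (w t - z))%C with (w t) by ring. }
  rewrite E1. unfold K.
  transitivity (CInt (fun t => f z * (w t / (w t - z)))%C 0 (2 * PI)).
  { apply CInt_ext. intros t. now replace (z + 0 * (w t - z))%C with z by ring. }
  rewrite CInt_scal.
  - unfold w. rewrite cauchy_kernel_integral by exact Hz. ring.
  - intros t. unfold w. ccont. apply N.
Qed.

End Cauchy.

(** * Power series expansion *)

Lemma CV_radius_pos (a : nat -> R) (x : R) :
  0 < x -> ex_series (fun n => a n * x ^ n) -> Rbar_lt 0 (CV_radius a).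
Proof.
  intros Hx Ha.
  destruct (Rbar_lt_dec 0 (CV_radius a)) as [H | H]; [exact H |]. exfalso.
  apply (CV_disk_outside a x).
  - apply Rbar_not_lt_le in H. apply Rbar_le_lt_trans with (1 := H).
    rewrite Rabs_pos_eq; simpl; lra.
  - apply ex_series_lim_0, Ha.
Qed.

Lemma real_power_series_unique (a b : nat -> R) (g : R -> R) (r : R) :
  0 < r ->
  (forall x, Rabs x < r -> is_series (fun n => a n * x ^ n) (g x)) ->
  (forall x, Rabs x < r -> is_series (fun n => b n * x ^ n) (g x)) ->
  forall n, a n = b n.
Proof.
  intros Hr Ha Hb n.
  assert (Hr2 : Rabs (r / 2) < r) by (rewrite Rabs_pos_eq; lra).
  apply PSeries_ext_recip.
  - apply CV_radius_pos with (r / 2); [lra |]. eexists. now apply Ha.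
  - apply CV_radius_pos with (r / 2); [lra |]. eexists. now apply Hb.
  - exists (mkposreal r Hr). intros x Hx.
    assert (Hx' : Rabs x < r) by (rewrite <- (Rminus_0_r x); exact Hx).
    unfold PSeries. rewrite (is_series_unique _ _ (Ha x Hx')).
    now rewrite (is_series_unique _ _ (Hb x Hx')).
Qed.

Lemma sum_n_C_parts (u : nat -> C) (n : nat) :
  sum_n u n = (sum_n (fun k => fst (u k)) n, sum_n (fun k => snd (u k)) n).
Proof.
  induction n.
  - rewrite !sum_O. now destruct (u O).
  - rewrite !sum_Sn, IHn. reflexivity.
Qed.

Lemma is_series_parts (u : nat -> C) (l : C) :
  (forall eps : posreal, exists N0, forall n, (N0 <= n)%nat ->
     Cmod (l - sum_n u n) < eps) ->
  is_series (fun k => fst (u k)) (fst l) /\ is_series (fun k => snd (u k)) (snd l).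
Proof.
  intros H. split; apply filterlim_locally; intros eps; destruct (H eps) as [N0 HN];
    exists N0; intros n Hn; specialize (HN n Hn); rewrite Cmod_minus_sym, sum_n_C_parts in HN;
    eapply Rle_lt_trans with (2 := HN); eapply Rle_trans with (2 := Rmax_Cmod _).
  - apply Rmax_l.
  - apply Rmax_r.
Qed.

(** The restrictions to the real axis of the real and imaginary parts already
    determine the coefficients, so the uniqueness theorem for real power series
    suffices. *)
Lemma power_series_unique (a b : nat -> C) (g : C -> C) (r : R) :
  0 < r ->
  (forall (z : C) (eps : posreal), Cmod z < r -> exists N0, forall n, (N0 <= n)%nat ->
     Cmod (g z - sum_n (fun k => a k * z ^ k)%C n) < eps) ->
  (forall (z : C) (eps : posreal), Cmod z < r -> exists N0, forall n, (N0 <= n)%nat ->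
     Cmod (g z - sum_n (fun k => b k * z ^ k)%C n) < eps) ->
  forall n, a n = b n.
Proof.
  intros Hr Ha Hb n.
  assert (P : forall c : nat -> C,
    (forall (z : C) (eps : posreal), Cmod z < r -> exists N0, forall n, (N0 <= n)%nat ->
     Cmod (g z - sum_n (fun k => c k * z ^ k)%C n) < eps) ->
    forall x : R, Rabs x < r ->
      is_series (fun k => fst (c k) * x ^ k) (fst (g x)) /\
      is_series (fun k => snd (c k) * x ^ k) (snd (g x))).
  { intros c Hc x Hx. rewrite <- Cmod_R in Hx.
    destruct (is_series_parts _ _ (fun eps => Hc _ eps Hx)) as [H1 H2].
    split; [eapply is_series_ext with (2 := H1) | eapply is_series_ext with (2 := H2)];
      intros k; rewrite <- RtoC_pow; simpl; ring. }
  apply injective_projections.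
  - apply (real_power_series_unique (fun k => fst (a k)) (fun k => fst (b k))
             (fun x => fst (g x)) r Hr);
      intros x Hx; [apply (P a Ha x Hx) | apply (P b Hb x Hx)].
  - apply (real_power_series_unique (fun k => snd (a k)) (fun k => snd (b k))
             (fun x => snd (g x)) r Hr);
      intros x Hx; [apply (P a Ha x Hx) | apply (P b Hb x Hx)].
Qed.

Lemma ex_series_linear_geom (q : R) :
  0 <= q < 1 -> ex_series (fun n => INR (S n) * q ^ n).
Proof.
  intros Hq.
  destruct (Req_dec q 0) as [-> | Hq0].
  - apply ex_series_incr_1. apply ex_series_ext with (fun _ => 0).
    + intros n. simpl. ring.
    + exists 0. apply filterlim_ext with (fun _ : nat => 0); [| apply filterlim_const].
      intros n. rewrite sum_n_const. ring.
  - apply ex_series_Rabs, ex_series_DAlembert with q; [lra | |].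
    + intros n. apply Rmult_integral_contrapositive_currified.
      * apply not_0_INR. lia.
      * now apply pow_nonzero.
    + apply is_lim_seq_ext with (fun n => q * (1 + / INR (S n))).
      * intros n. assert (0 < INR (S n)) by apply lt_0_INR, Nat.lt_0_succ.
        rewrite (S_INR (S n)).
        replace ((INR (S n) + 1) * q ^ S n / (INR (S n) * q ^ n)) with (q * (1 + / INR (S n)))
          by (simpl pow; field; split; [now apply pow_nonzero | lra]).
        symmetry. apply Rabs_pos_eq. apply Rmult_le_pos; [lra |].
        apply Rplus_le_le_0_compat; [lra |]. left. now apply Rinv_0_lt_compat.
      * assert (L : is_lim_seq (fun n => / INR (S n)) 0).
        { apply (is_lim_seq_incr_1 (fun n => / INR n)).
          apply (is_lim_seq_inv _ p_infty); [apply is_lim_seq_INR | discriminate]. }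
        replace (Finite q) with (Rbar_mult q (1 + 0)) by (simpl; f_equal; ring).
        apply is_lim_seq_scal_l, is_lim_seq_plus'; [apply is_lim_seq_const | exact L].
Qed.

Section Expansion.
Context (F f : C -> C).
Context (f_cont : forall z, unit_disc z -> continuous f z).
Context (F_cont : forall z, unit_disc z -> continuous F z).
Context (F_chain : forall (g : R -> C) (x : R) (l : C),
  is_derive_C g x l -> unit_disc (g x) ->
  is_derive_C (fun t => F (g t)) x (l * f (g x))%C).

(** Since [F' = f], the usual coefficient formula gives the coefficient of degree
    [n + 1] of [F]; the factor [n + 1] turns it into that of degree [n] of [f]. *)
Definition cauchy_coef (r : R) (n : nat) : C :=
  (/ RtoC (2 * PI) * RtoC (INR (S n)) *
   CInt (fun t => F (circle r t) * / circle r t ^ S n) 0 (2 * PI))%C.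

(** The tail of the expansion of [w / (w - z) ^ 2], that is, of the sum of
    [(k + 1) z ^ k / w ^ (k + 1)], from the term [k = n] on; for [n = 0] it is
    the kernel itself. *)
Definition kernel_tail (r : R) (z : C) (n : nat) (t : R) : C :=
  let w := circle r t in
  (z ^ n * / w ^ n * (RtoC (INR (S n)) * w - RtoC (INR n) * z)
    / ((w - z) * (w - z)))%C.

Section Radius.
Context (r : R) (Hr : 0 < r < 1).

Lemma circle_neq_0 (t : R) : circle r t <> 0.
Proof.
  replace (circle r t) with (circle r t - 0)%C by ring.
  apply circle_neq. rewrite Cmod_0. lra.
Qed.

Lemma circle_in_disc (t : R) : unit_disc (circle r t).
Proof. unfold unit_disc. rewrite Cmod_circle; lra. Qed.

Lemma F_circle_continuous (t : R) : continuous (fun t => F (circle r t)) t.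
Proof.
  apply (continuous_comp (circle r) F); [apply continuous_circle |].
  apply F_cont, circle_in_disc.
Qed.

Lemma kernel_tail_continuous (z : C) (n : nat) (t : R) :
  Cmod z < r -> continuous (kernel_tail r z n) t.
Proof.
  intros Hz. unfold kernel_tail.
  ccont.
  - apply Cpow_nz, circle_neq_0.
  - apply Cmult_neq_0; now apply circle_neq.
Qed.

Lemma kernel_tail_step (z : C) (n : nat) (t : R) : Cmod z < r ->
  (kernel_tail r z n t - kernel_tail r z (S n) t)%C =
  (RtoC (INR (S n)) * z ^ n * / circle r t ^ S n)%C.
Proof.
  intros Hz. unfold kernel_tail. rewrite (S_INR (S n)), (S_INR n), !RtoC_plus, !Cpow_S.
  set (w := circle r t).
  assert (w <> 0) by apply circle_neq_0.
  assert ((w - z)%C <> 0) by now apply circle_neq.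
  assert (w ^ n <> 0)%C by now apply Cpow_nz.
  field. auto.
Qed.

(** Telescoping: consecutive tails differ by one term of the expansion
    ([kernel_tail_step]), whose integral against [F] is one term of the series,
    and the whole kernel gives [f z] by [cauchy_formula], all up to the factor
    [2 * PI]. *)
Lemma cauchy_remainder (z : C) (n : nat) : Cmod z < r ->
  (RtoC (2 * PI) * (f z - sum_n (fun k => cauchy_coef r k * z ^ k) n))%C =
  CInt (fun t => F (circle r t) * kernel_tail r z (S n) t)%C 0 (2 * PI).
Proof.
  intros Hz.
  assert (HP : RtoC (2 * PI) <> 0).
  { intros E. apply RtoC_inj in E. pose proof PI_RGT_0. lra. }
  assert (Hc : forall k t, continuous (fun t => F (circle r t) * kernel_tail r z k t)%C t).
  { intros k t. apply continuous_Cmult; [apply F_circle_continuous |].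
    now apply kernel_tail_continuous. }
  assert (Step : forall k,
    (CInt (fun t => F (circle r t) * kernel_tail r z k t) 0 (2 * PI)
     - CInt (fun t => F (circle r t) * kernel_tail r z (S k) t) 0 (2 * PI))%C
    = (RtoC (2 * PI) * (cauchy_coef r k * z ^ k))%C).
  { intros k. rewrite <- CInt_minus by apply Hc.
    transitivity (CInt (fun t => RtoC (INR (S k)) * z ^ k *
      (F (circle r t) * / circle r t ^ S k))%C 0 (2 * PI)).
    - apply CInt_ext. intros t.
      transitivity (F (circle r t) * (kernel_tail r z k t - kernel_tail r z (S k) t))%C; [ring |].
      rewrite kernel_tail_step by exact Hz. ring.
    - rewrite CInt_scal.
      + unfold cauchy_coef. field. exact HP.
      + intros t. apply continuous_Cmult; [apply F_circle_continuous |].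
        ccont. apply Cpow_nz, circle_neq_0. }
  assert (Zero : CInt (fun t => F (circle r t) * kernel_tail r z 0 t)%C 0 (2 * PI)
    = (RtoC (2 * PI) * f z)%C).
  { rewrite <- (cauchy_formula F f f_cont F_cont F_chain r z) by (auto; lra).
    apply CInt_ext. intros t. unfold kernel_tail. simpl. field.
    now apply circle_neq. }
  induction n.
  - rewrite sum_O.
    replace (CInt _ _ _) with (RtoC (2 * PI) * f z - RtoC (2 * PI) * (cauchy_coef r 0 * z ^ 0))%C;
      [ring |].
    rewrite <- Step, Zero. ring.
  - rewrite sum_Sn. change (@plus _ ?a ?b) with (Cplus a b).
    transitivity (RtoC (2 * PI) * (f z - sum_n (fun k => cauchy_coef r k * z ^ k)%C n)
       - RtoC (2 * PI) * (cauchy_coef r (S n) * z ^ S n))%C; [ring |].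
    rewrite IHn, <- Step. ring.
Qed.

Lemma F_circle_bounded :
  exists M, 0 <= M /\ forall t, 0 <= t <= 2 * PI -> Cmod (F (circle r t)) <= M.
Proof.
  destruct (bounded_continuity (V := C_R_NormedModule)
    (fun t => F (circle r t)) 0 (2 * PI)) as [M HM].
  { intros t _. apply F_circle_continuous. }
  exists (Rmax 0 M). split; [apply Rmax_l |]. intros t Ht. specialize (HM t Ht).
  rewrite norm_C_R in HM. eapply Rle_trans; [left; exact HM | apply Rmax_r].
Qed.

Lemma kernel_tail_bound (s : R) (z : C) (n : nat) (t : R) :
  0 <= s < r -> Cmod z <= s ->
  Cmod (kernel_tail r z n t) <= 2 * r / (r - s) ^ 2 * (INR (S n) * (s / r) ^ n).
Proof.
  intros Hs Hz. unfold kernel_tail.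
  pose proof (circle_minus_lower r t s z Hz ltac:(lra)) as L.
  assert (Hw : Cmod (circle r t) = r) by (apply Cmod_circle; lra).
  assert (Nz : (circle r t - z)%C <> 0) by (apply circle_neq; lra).
  assert (N0 := circle_neq_0 t).
  unfold Cdiv. rewrite !Cmod_mult, !Cmod_inv by (try apply Cmult_neq_0; auto using Cpow_nz).
  rewrite Cmod_mult, !Cmod_pow, Hw.
  assert (Hz0 := Cmod_ge_0 z).
  assert (P1 : Cmod z ^ n * / r ^ n <= (s / r) ^ n).
  { unfold Rdiv. rewrite Rpow_mult_distr, pow_inv.
    apply Rmult_le_compat_r; [left; apply Rinv_0_lt_compat, pow_lt; lra |].
    apply pow_incr; lra. }
  assert (P2 : Cmod (RtoC (INR (S n)) * circle r t - RtoC (INR n) * z) <= 2 * r * INR (S n)).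
  { eapply Rle_trans; [apply Cmod_triangle |].
    rewrite Cmod_opp, !Cmod_mult, !Cmod_R, Hw, !Rabs_pos_eq by apply pos_INR.
    rewrite S_INR. pose proof (pos_INR n). nra. }
  assert (P3 : / (Cmod (circle r t - z) * Cmod (circle r t - z)) <= / (r - s) ^ 2).
  { apply Rinv_le_contravar; [apply pow_lt; lra |]. simpl. rewrite Rmult_1_r.
    apply Rmult_le_compat; lra. }
  replace (2 * r / (r - s) ^ 2 * (INR (S n) * (s / r) ^ n))
    with ((s / r) ^ n * (2 * r * INR (S n)) * / (r - s) ^ 2) by (unfold Rdiv; ring).
  apply Rmult_le_compat; auto.
  - apply Rmult_le_pos; [| apply Cmod_ge_0].
    apply Rmult_le_pos; [apply pow_le; lra | left; apply Rinv_0_lt_compat, pow_lt; lra].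
  - left. apply Rinv_0_lt_compat. apply Rmult_lt_0_compat; lra.
  - apply Rmult_le_compat; auto; [| apply Cmod_ge_0].
    apply Rmult_le_pos; [apply pow_le; lra | left; apply Rinv_0_lt_compat, pow_lt; lra].
Qed.

Lemma cauchy_series_remainder_bound (s : R) : 0 <= s < r ->
  exists B, 0 <= B /\ forall z n, Cmod z <= s ->
    Cmod (f z - sum_n (fun k => cauchy_coef r k * z ^ k)%C n) <=
    B * (INR (S (S n)) * (s / r) ^ S n).
Proof.
  intros Hs. destruct F_circle_bounded as [M [HM0 HM]].
  assert (0 <= 2 * r / (r - s) ^ 2).
  { apply Rdiv_le_0_compat; [lra | apply pow_lt; lra]. }
  exists (M * (2 * r / (r - s) ^ 2)). split; [now apply Rmult_le_pos |].
  intros z n Hz. pose proof PI_RGT_0 as HPI.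
  apply Rmult_le_reg_l with (2 * PI); [lra |].
  replace (2 * PI * Cmod _) with
    (Cmod (RtoC (2 * PI) * (f z - sum_n (fun k => cauchy_coef r k * z ^ k)%C n)))
    by (rewrite Cmod_mult, Cmod_R, Rabs_pos_eq; lra).
  rewrite cauchy_remainder by lra.
  replace (2 * PI) with (2 * PI - 0) at 2 by ring.
  apply CInt_bound; [lra | |].
  - intros t. apply continuous_Cmult; [apply F_circle_continuous |].
    apply kernel_tail_continuous. lra.
  - intros t Ht. rewrite Cmod_mult, Rmult_assoc. apply Rmult_le_compat; auto using Cmod_ge_0.
    now apply kernel_tail_bound.
Qed.

Lemma cauchy_coef_bound :
  exists B, 0 <= B /\ forall n, Cmod (cauchy_coef r n) * r ^ n <= B * INR (S n).
Proof.
  destruct F_circle_bounded as [M [HM0 HM]].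
  assert (Hir : 0 < / r) by (apply Rinv_0_lt_compat; lra).
  exists (M * / r). split; [apply Rmult_le_pos; lra |].
  intros n. pose proof PI_RGT_0 as HPI. unfold cauchy_coef.
  assert (HP : RtoC (2 * PI) <> 0) by (intros E; apply RtoC_inj in E; lra).
  rewrite !Cmod_mult, Cmod_inv, !Cmod_R, !Rabs_pos_eq by (try apply pos_INR; try lra; exact HP).
  assert (Hrn : 0 < r ^ n) by (apply pow_lt; lra).
  assert (H : Cmod (CInt (fun t => F (circle r t) * / circle r t ^ S n)%C 0 (2 * PI))
    <= (2 * PI - 0) * (M * / r ^ S n)).
  { apply CInt_bound; [lra | |].
    - intros t. apply continuous_Cmult; [apply F_circle_continuous |].
      ccont. apply Cpow_nz, circle_neq_0.
    - intros t Ht. rewrite Cmod_mult, Cmod_inv, Cmod_pow, Cmod_circle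
        by (try lra; apply Cpow_nz, circle_neq_0).
      apply Rmult_le_compat_r; [| auto].
      left. apply Rinv_0_lt_compat, pow_lt. lra. }
  replace (M * / r * INR (S n)) with
    (/ (2 * PI) * INR (S n) * ((2 * PI - 0) * (M * / r ^ S n)) * r ^ n)
    by (simpl pow; field; lra).
  apply Rmult_le_compat_r; [lra |].
  apply Rmult_le_compat_l; [| exact H].
  apply Rmult_le_pos; [left; apply Rinv_0_lt_compat; lra | apply pos_INR].
Qed.

Lemma cauchy_series_uniform (s : R) (eps : posreal) : 0 <= s < r ->
  exists N0, forall n, (N0 <= n)%nat -> forall z, Cmod z <= s ->
    Cmod (f z - sum_n (fun k => cauchy_coef r k * z ^ k)%C n) < eps.
Proof.
  intros Hs. destruct (cauchy_series_remainder_bound s Hs) as [B [HB0 HB]].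
  assert (Hq : 0 <= s / r < 1).
  { split; [apply Rdiv_le_0_compat; lra | apply Rlt_div_l; lra]. }
  pose proof (ex_series_lim_0 _ (ex_series_linear_geom _ Hq)) as L.
  apply is_lim_seq_incr_1 in L.
  apply (is_lim_seq_scal_l _ B) in L. simpl in L. rewrite Rmult_0_r in L.
  apply is_lim_seq_spec in L. destruct (L eps) as [N0 HN0].
  exists N0. intros n Hn z Hz. eapply Rle_lt_trans; [now apply HB |].
  specialize (HN0 n Hn). rewrite Rminus_0_r in HN0.
  eapply Rle_lt_trans; [apply Rle_abs | exact HN0].
Qed.

Lemma cauchy_series_abs (s : R) : 0 <= s < r ->
  ex_series (fun n => Cmod (cauchy_coef r n) * s ^ n).
Proof.
  intros Hs. destruct cauchy_coef_bound as [B [HB0 HB]].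
  assert (Hq : 0 <= s / r < 1).
  { split; [apply Rdiv_le_0_compat; lra | apply Rlt_div_l; lra]. }
  apply (ex_series_le (V := R_CompleteNormedModule)) with (fun n => B * (INR (S n) * (s / r) ^ n)).
  - intros n. change (norm (V := R_CompleteNormedModule)) with Rabs.
    assert (Hsr : 0 <= (s / r) ^ n) by (apply pow_le; lra).
    replace (s ^ n) with (r ^ n * (s / r) ^ n) by (rewrite <- Rpow_mult_distr; f_equal; field; lra).
    rewrite Rabs_pos_eq.
    + specialize (HB n). nra.
    + apply Rmult_le_pos; [apply Cmod_ge_0 |].
      apply Rmult_le_pos; [apply pow_le; lra | exact Hsr].
  - apply (ex_series_scal_l B (fun n => INR (S n) * (s / r) ^ n)).
    now apply ex_series_linear_geom.
Qed.

End Radius.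

(** Both series converge to [f] on the smaller of the two discs. *)
Lemma cauchy_coef_radius (r r' : R) (n : nat) : 0 < r < 1 -> 0 < r' < 1 ->
  cauchy_coef r n = cauchy_coef r' n.
Proof.
  intros Hr Hr'.
  apply (power_series_unique _ _ f (Rmin r r')); [apply Rmin_glb_lt; lra | |];
    intros z eps Hz; pose proof (Cmod_ge_0 z).
  - destruct (cauchy_series_uniform r Hr (Cmod z) eps) as [N0 H0].
    + split; [lra |]. apply Rlt_le_trans with (1 := Hz), Rmin_l.
    + exists N0. intros k Hk. apply H0; [exact Hk | lra].
  - destruct (cauchy_series_uniform r' Hr' (Cmod z) eps) as [N0 H0].
    + split; [lra |]. apply Rlt_le_trans with (1 := Hz), Rmin_r.
    + exists N0. intros k Hk. apply H0; [exact Hk | lra].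
Qed.

(** The radius [1 / 2] used to define the coefficients is arbitrary; convergence for
    [|z| <= s] is read off the representation with the radius [(1 + s) / 2]. *)
Lemma disc_power_series : exists a : nat -> C, forall s, 0 < s < 1 ->
  ex_series (fun n => Cmod (a n) * s ^ n) /\
  forall eps : posreal, exists N0, forall n, (N0 <= n)%nat -> forall z, Cmod z <= s ->
    Cmod (f z - sum_n (fun k => a k * z ^ k)%C n) < eps.
Proof.
  exists (cauchy_coef (/ 2)). intros s Hs.
  assert (Hr : 0 < (1 + s) / 2 < 1) by lra.
  assert (E : forall n, cauchy_coef ((1 + s) / 2) n = cauchy_coef (/ 2) n)
    by (intros; apply cauchy_coef_radius; lra).
  split.
  - apply ex_series_ext with (fun n => Cmod (cauchy_coef ((1 + s) / 2) n) * s ^ n).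
    + intros n. now rewrite E.
    + apply (cauchy_series_abs _ Hr s); lra.
  - intros eps. destruct (cauchy_series_uniform _ Hr s eps) as [N0 H0]; [lra |].
    exists N0. intros n Hn z Hz.
    rewrite (sum_n_ext _ (fun k => cauchy_coef ((1 + s) / 2) k * z ^ k)%C); [now apply H0 |].
    intros k. now rewrite E.
Qed.

End Expansion.

(** * Convergence in the space of continuous functions on the disc *)

(** The supremum is an extended real projected to [R]; it is finite here because
    it lies between the value at 0 and [M]. *)
Lemma sup_seminorm_le (r M : R) (g : C -> C) :
  0 <= r -> (forall z, Cmod z <= r -> Cmod (g z) <= M) -> sup_seminorm r g <= M.
Proof.
  intros Hr HM. unfold sup_seminorm.
  destruct (Lub_Rbar_correct
    (fun y : R => exists z : C, Cmod z <= r /\ y = Cmod (g z))) as [U L].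
  assert (H1 : Rbar_le
    (Lub_Rbar (fun y : R => exists z : C, Cmod z <= r /\ y = Cmod (g z))) M).
  { apply L. intros y [z [Hz ->]]. simpl. now apply HM. }
  assert (H2 : Rbar_le (Cmod (g 0))
    (Lub_Rbar (fun y : R => exists z : C, Cmod z <= r /\ y = Cmod (g z)))).
  { apply U. exists 0. now rewrite Cmod_0. }
  destruct (Lub_Rbar _); simpl in *; tauto.
Qed.

Lemma radii_bound (radii : list R) :
  (forall r, In r radii -> 0 < r < 1) ->
  exists s, 0 < s < 1 /\ forall r, In r radii -> r <= s.
Proof.
  induction radii as [| r0 radii IH]; intros H.
  - exists (/ 2). split; [lra | intros r []].
  - destruct IH as [s [Hs Hle]]; [intros r Hr; apply H; now right |].
    assert (H0 : 0 < r0 < 1) by (apply H; now left).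
    exists (Rmax r0 s). split.
    + split; [apply Rlt_le_trans with (1 := proj1 Hs), Rmax_r | apply Rmax_lub_lt; lra].
    + intros r [<- | Hr]; [apply Rmax_l |].
      apply Rle_trans with (1 := Hle r Hr), Rmax_r.
Qed.

(** The suprema over discs increase with the radius, so the largest of finitely many
    radii suffices. *)
Lemma nbhs_C_disc_sup (g : C -> C) (V : (C -> C) -> Prop) :
  nbhs_C_disc g V ->
  exists (s : R) (eps : posreal), 0 < s < 1 /\
    forall h, C_disc h -> (forall z, Cmod z <= s -> Cmod (h z - g z) <= eps) -> V h.
Proof.
  intros (radii & eps & Hr & HV). destruct (radii_bound radii Hr) as [s [Hs Hle]].
  exists s, (pos_div_2 eps). split; [exact Hs |]. intros h Hh Hz. apply HV; [exact Hh |].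
  intros r Hin. apply Rle_lt_trans with (pos_div_2 eps).
  - apply sup_seminorm_le; [apply Rlt_le, Hr, Hin |].
    intros z Hzr. apply Hz. apply Rle_trans with (1 := Hzr), Hle, Hin.
  - simpl. pose proof (cond_pos eps). lra.
Qed.

Lemma C_disc_of_continuous (g : C -> C) :
  (forall z, unit_disc z -> continuous g z) -> C_disc g.
Proof.
  intros H z Hz. apply filterlim_filter_le_1 with (2 := H z Hz).
  intros P HP. unfold within. now apply filter_imp with (2 := HP).
Qed.

Lemma C_disc_monomial (c : C) (n : nat) : C_disc (fun z => c * monomial n z)%C.
Proof.
  apply C_disc_of_continuous. intros z _. unfold monomial.
  apply (continuous_Cmult (U := C_UniformSpace)); [apply continuous_const |].
  apply (continuous_Cpow (U := C_UniformSpace)), continuous_id.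
Qed.

Lemma C_disc_sum_n (g : nat -> C -> C) (N : nat) :
  (forall n z, continuous (g n) z) -> C_disc (fun z => sum_n (fun n => g n z) N).
Proof.
  intros H. apply C_disc_of_continuous. intros z _.
  induction N.
  - apply continuous_ext with (g O); [| apply H]. intros y. now rewrite sum_O.
  - apply continuous_ext with (fun z => sum_n (fun n => g n z) N + g (S N) z)%C.
    + intros y. now rewrite sum_Sn.
    + apply (continuous_Cplus (U := C_UniformSpace)); [exact IHN | apply H].
Qed.

(** Continuity at 0 gives a radius [s] and an [eps] such that [p h < 1] as soon as
    [|h| <= eps] on [|z| <= s]; rescaling [g] by [eps / M] gives the constant [1 / eps].
    The bound [M] is positive, and not only nonnegative, for the sake of this scaling. *)
Lemma continuous_seminorm_bound (p : (C -> C) -> R) :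
  continuous_seminorm_C_disc p ->
  exists (s K : R), 0 < s < 1 /\ 0 <= K /\
    forall g (M : R), C_disc g -> 0 < M ->
      (forall z, Cmod z <= s -> Cmod (g z) <= M) -> p g <= K * M.
Proof.
  intros [Hp Hc].
  assert (H0 : C_disc (fun _ => RtoC 0))
    by (apply C_disc_of_continuous; intros; apply continuous_const).
  assert (P0 : p (fun _ => RtoC 0) = 0).
  { rewrite (seminorm_ext p Hp _ (fun z => 0 * RtoC 0)%C).
    - rewrite (seminorm_scal p Hp 0 (fun _ => RtoC 0)) by exact H0. rewrite Cmod_0. ring.
    - exact H0.
    - apply C_disc_of_continuous; intros; apply continuous_const.
    - intros z _. ring. }
  destruct (nbhs_C_disc_sup _ _
    (Hc _ H0 (ball (p (fun _ => RtoC 0)) 1) (locally_ball _ (mkposreal 1 Rlt_0_1))))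
    as (s & eps & Hs & HV).
  assert (He := cond_pos eps).
  exists s, (/ eps). split; [exact Hs |]. split; [left; now apply Rinv_0_lt_compat |].
  intros g M Hg HM Hz.
  assert (Hk : 0 < eps / M) by now apply Rdiv_lt_0_compat.
  assert (Hgk : C_disc (fun z => RtoC (eps / M) * g z)%C).
  { apply C_disc_of_continuous. intros z Hd.
    apply (continuous_Cmult (U := C_UniformSpace)); [apply continuous_const |].
    now apply continuous_on_disc. }
  assert (B : Rabs (p (fun z => RtoC (eps / M) * g z)%C - p (fun _ => RtoC 0)) < 1).
  { apply HV; [exact Hgk |]. intros z Hzs.
    replace (RtoC (eps / M) * g z - 0)%C with (RtoC (eps / M) * g z)%C by ring.
    rewrite Cmod_mult, Cmod_R, Rabs_pos_eq by lra.
    apply Rle_trans with (eps / M * M); [| right; field; lra].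
    apply Rmult_le_compat_l; [lra | now apply Hz]. }
  rewrite P0, Rminus_0_r, (seminorm_scal p Hp), Cmod_R in B by exact Hg.
  rewrite (Rabs_pos_eq (eps / M)) in B by lra.
  pose proof (seminorm_ge_0 p Hp g Hg).
  rewrite Rabs_pos_eq in B by (apply Rmult_le_pos; lra).
  apply Rmult_le_reg_l with (eps / M); [exact Hk |].
  replace (eps / M * (/ eps * M)) with 1 by (field; lra). lra.
Qed.

Lemma absolutely_convergent_monomials (a : nat -> C) :
  (forall s, 0 < s < 1 -> ex_series (fun n => Cmod (a n) * s ^ n)) ->
  absolutely_convergent_C_disc (fun n z => a n * monomial n z)%C.
Proof.
  intros Ha p Hp.
  destruct (continuous_seminorm_bound p Hp) as (s & K & Hs & HK & HB).
  destruct Hp as [Hp _].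
  assert (Hm : forall n, C_disc (monomial n)).
  { intros n. apply C_disc_of_continuous. intros z _.
    apply (continuous_Cpow (U := C_UniformSpace)), continuous_id. }
  apply (ex_series_le (V := R_CompleteNormedModule)) with (fun n => K * (Cmod (a n) * s ^ n)).
  - intros n. change (norm (V := R_CompleteNormedModule)) with Rabs.
    rewrite (seminorm_scal p Hp) by apply Hm.
    pose proof (Cmod_ge_0 (a n)) as Ha0.
    pose proof (seminorm_ge_0 p Hp _ (Hm n)).
    rewrite Rabs_pos_eq by now apply Rmult_le_pos.
    assert (p (monomial n) <= K * s ^ n).
    { apply HB; [apply Hm | apply pow_lt; lra |]. intros z Hz. unfold monomial.
      rewrite Cmod_pow. apply pow_incr. split; [apply Cmod_ge_0 | exact Hz]. }
    nra.
  - apply (ex_series_scal_l K (fun n => Cmod (a n) * s ^ n)). now apply Ha.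
Qed.

Lemma series_converges_monomials (a : nat -> C) (f : C -> C) :
  C_disc f ->
  (forall s, 0 < s < 1 -> forall eps : posreal, exists N0, forall n, (N0 <= n)%nat ->
     forall z, Cmod z <= s -> Cmod (f z - sum_n (fun k => a k * z ^ k)%C n) < eps) ->
  series_converges_C_disc (fun n z => a n * monomial n z)%C f.
Proof.
  intros Hf Ha. split; [exact Hf |]. split; [intros n; apply C_disc_monomial |].
  intros V HV. destruct (nbhs_C_disc_sup _ _ HV) as (s & eps & Hs & HVs).
  destruct (Ha s Hs eps) as [N0 HN]. exists N0. intros n Hn. apply HVs.
  - apply C_disc_sum_n. intros k z. apply (continuous_Cmult (U := C_UniformSpace)).
    + apply continuous_const.
    + apply (continuous_Cpow (U := C_UniformSpace)), continuous_id.
  - intros z Hz. rewrite Cmod_minus_sym. left. now apply HN.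
Qed.

Theorem theorem5p1 (f : C -> C) (Hf : morera_holomorphic unit_disc f) :
  exists a : nat -> C,
    absolutely_convergent_C_disc (fun (n : nat) (z : C) => (a n * monomial n z)%C) /\
    series_converges_C_disc (fun (n : nat) (z : C) => (a n * monomial n z)%C) f.
Proof.
  destruct (disc_power_series (disc_primitive f) f) as [a Ha].
  - now apply morera_continuous.
  - now apply primitive_continuous.
  - now apply primitive_chain.
  - exists a. split.
    + apply absolutely_convergent_monomials. intros s Hs. now apply Ha.
    + apply series_converges_monomials; [apply Hf |]. intros s Hs. now apply Ha.
Qed.
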